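(* Let $A,B,C,D\in\mathbb{R}^{n\times n}$, let $\mathcal M=\begin{bmatrix} C & D \\ A & -B \end{bmatrix}$ and $\varphi(z)=\mathcal M+z\mathcal M^\top$, and assume that $\det\varphi(z)\neq 0$ for all $z\in\mathbb{C}$ with $|z|=1$. Define $$\mathcal A_{-1}=\begin{bmatrix} 0 & C \\ 0 & A \end{bmatrix},\quad \mathcal A_0=\begin{bmatrix} D & C^\top \\ -B & D^\top \end{bmatrix},\quad \mathcal A_1=\begin{bmatrix} A^\top & 0 \\ -B^\top & 0 \end{bmatrix},$$ and $$\mathcal Q(z)=\varphi(z)\begin{bmatrix} 0 & I \\ zI & 0 \end{bmatrix}=\mathcal A_{-1}+\mathcal A_0z+\mathcal A_1z^2.$$ Then the eigenvalues of the quadratic matrix polynomial $\mathcal Q(z)$ are (counted with multiplicity) the eigenvalues of $\varphi(z)$, plus $n$ eigenvalues equal to $0$ and $n$ eigenvalues at infinity. Moreover, the equation $DX+X^\top A-X^\top BX+C=0$ has a stabilizing solution $S$ if and only if the quadratic matrix equation $$\mathcal A_{-1}+\mathcal A_0Z+\mathcal A_1Z^2=0$$ has a solution $G$ with spectral radius less than one. In addition, $$G=\begin{bmatrix} 0 & S \\ 0 & W \end{bmatrix},\qquad W=-(D^\top-B^\top S)^{-1}(A-BS).$$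
   Context: A matrix polynomial $p(z)$ of size $N$ and degree (grade) $g$ (a pencil when $g=1$) is regular if $\det p(z)$ is not the zero polynomial; its finite eigenvalues are the zeros of $\det p(z)$, and $\infty$ is an eigenvalue of multiplicity $d$ if $\det p(z)$ has degree $gN-d$. Here $\varphi(z)$ has size $2n$ and grade $1$, and $\mathcal Q(z)$ has size $2n$ and grade $2$. If $X$ solves $DX+X^\top A-X^\top BX+C=0$, then $$\varphi(z)\begin{bmatrix} I \\ X \end{bmatrix}=\begin{bmatrix} -X^\top \\ I \end{bmatrix}\alpha(z),\qquad \alpha(z)=A-BX+z(D^\top-B^\top X),$$ so the columns of $\begin{bmatrix} I \\ X \end{bmatrix}$ span a deflating subspace of $\varphi(z)$, whose associated eigenvalues are those of the $n\times n$ pencil $\alpha(z)$. The solution $X$ is called stabilizing if all these eigenvalues lie in the open unit disk. *)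

(* Defs.v *)
From mathcomp Require Import all_boot all_order all_algebra.
From mathcomp Require Import complex.
From mathcomp Require Import classical_sets reals.

Set Implicit Arguments.
Unset Strict Implicit.
Unset Printing Implicit Defensive.

Import Order.TTheory GRing.Theory Num.Theory.

Local Open Scope ring_scope.

Section MatrixPolynomials.
Variable R : realType.
Implicit Types N g : nat.

Definition toC m n (P : 'M[R]_(m, n)) : 'M[R[i]]_(m, n) :=
  map_mx (real_complex R) P.

(* Matrix polynomials are matrices over R[i][z]: the coefficients are real,
   but the variable and the eigenvalues are complex. *)
Definition const_mxpoly N (P : 'M[R]_N) : 'M[{poly R[i]}]_N :=
  map_mx polyC (toC P).

Definition pencil N (P0 P1 : 'M[R]_N) : 'M[{poly R[i]}]_N :=
  const_mxpoly P0 + 'X *: const_mxpoly P1.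

Definition quadratic N (P0 P1 P2 : 'M[R]_N) : 'M[{poly R[i]}]_N :=
  const_mxpoly P0 + 'X *: const_mxpoly P1 + 'X^2 *: const_mxpoly P2.

Definition regular N (p : 'M[{poly R[i]}]_N) : bool := \det p != 0.

(* Multiplicity of a point of the extended complex plane (None is infinity)
   as an eigenvalue of a regular matrix polynomial p of size N and grade g.
   If the entries of p have degree at most g, as the grade requires, then
   \det p has degree (size (\det p)).-1 <= g * N, so the subtraction does not
   truncate. *)
Definition eig_mult g N (p : 'M[{poly R[i]}]_N) (x : option R[i]) : nat :=
  if x is Some l then mup l (\det p)
  else (g * N - (size (\det p)).-1)%N.

Definition is_eig g N (p : 'M[{poly R[i]}]_N) (x : option R[i]) : bool :=
  (0 < eig_mult g p x)%N.

Definition in_unit_disk (x : option R[i]) : bool :=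
  if x is Some l then `|l| < 1 else false.

(* The supremum is that of the finite set of the moduli of the complex
   eigenvalues, hence their maximum when N > 0. *)
Definition spectral_radius N (P : 'M[R]_N) : R :=
  sup [set ComplexField.Normc.normc l | l in [set l | eigenvalue (toC P) l]]%classic.

Section TRiccati.
Variables (n : nat) (A B C D : 'M[R]_n).

Definition calM : 'M[R]_(n + n) := block_mx C D A (- B).

Definition phi : 'M[{poly R[i]}]_(n + n) := pencil calM calM^T.

Definition calAm1 : 'M[R]_(n + n) := block_mx 0 C 0 A.
Definition calA0 : 'M[R]_(n + n) := block_mx D C^T (- B) D^T.
Definition calA1 : 'M[R]_(n + n) := block_mx A^T 0 (- B^T) 0.

Definition calQ : 'M[{poly R[i]}]_(n + n) :=
  phi *m block_mx 0 1%:M 'X%:M 0.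

Definition tRiccati_solution (X : 'M[R]_n) : Prop :=
  D *m X + X^T *m A - X^T *m B *m X + C = 0.

Definition alpha (X : 'M[R]_n) : 'M[{poly R[i]}]_n :=
  pencil (A - B *m X) (D^T - B^T *m X).

(* Infinity does not lie in the unit disk, so it may not be an eigenvalue of
   alpha X. *)
Definition stabilizing_solution (X : 'M[R]_n) : Prop :=
  [/\ tRiccati_solution X, regular (alpha X) &
      forall x, is_eig 1 (alpha X) x -> in_unit_disk x].

Definition qme_solution (Z : 'M[R]_(n + n)) : Prop :=
  calAm1 + calA0 *m Z + calA1 *m (Z *m Z) = 0.

End TRiccati.
End MatrixPolynomials.

(* Main.v *)
(* Put U_S = [I; S] and M = calM.  A matrix S is a stabilizing solution exactly
   when M U_S + M^T U_S W = 0 for some W with spectrum in the open unit disk,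
   and the quadratic equation for G reads M V + M^T V G = 0 with
   V = [0 I; G11 G12].  For any relation M V + M^T V T = 0 with T stable,
   K = V^T M V satisfies the Stein equation T^T K T = K, hence vanishes; as
   M + M^T = phi(1) is invertible, V then has rank at most half the size of M.
   Applied to the V coming from G, this rank bound gives G11 = 0, and the
   invertibility of phi(1) then gives G21 = 0, so that G = [0 S; 0 W] with S
   stabilizing.  Applied to [U_S U_S'], it shows that S is unique.  No counting
   of the eigenvalues of Q is needed. *)

Require Import Defs.
From mathcomp Require Import all_boot all_order perm all_algebra.
From mathcomp Require Import complex.
From mathcomp Require Import classical_sets reals.
From mathcomp Require Import zify.

Set Implicit Arguments.
Unset Strict Implicit.
Unset Printing Implicit Defensive.

Import Order.TTheory GRing.Theory Num.Theory.

Local Open Scope ring_scope.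

(** * Characteristic polynomials and the Stein equation *)

Lemma char_poly_ublock (T : comNzRingType) m k (P : 'M[T]_m) (Q : 'M[T]_(m, k))
    (U : 'M[T]_k) :
  char_poly (block_mx P Q 0 U) = char_poly P * char_poly U.
Proof.
rewrite /char_poly /char_poly_mx map_block_mx map_mx0 scalar_mx_block.
by rewrite opp_block_mx add_block_mx oppr0 !add0r det_ublock.
Qed.

Lemma char_poly_tr (T : comNzRingType) m (P : 'M[T]_m) :
  char_poly P^T = char_poly P.
Proof.
by rewrite /char_poly /char_poly_mx -map_trmx -[RHS]det_tr linearB /= tr_scalar_mx.
Qed.

(* If K W = l K for a root l of char_poly W, then K = l V K, so l^-1 would be an
   eigenvalue of V; the induction peels off the factors W - l of
   char_poly W evaluated at W, using that K (W - l) is again a solution. *)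
Lemma stein_eq0 (F : closedFieldType) m k (V : 'M[F]_m) (W : 'M[F]_k)
    (K : 'M[F]_(m, k)) :
    (forall l u, root (char_poly V) l -> root (char_poly W) u -> l * u != 1) ->
  V *m K *m W = K -> K = 0.
Proof.
case: k W K => [|k] W K hVW; first by move=> _; rewrite [K]thinmx0.
have [s Ws] := closed_field_poly_normal (char_poly W).
rewrite (monicP (char_poly_monic W)) scale1r in Ws.
have hs l : l \in s -> root (char_poly W) l by rewrite Ws root_prod_XsubC.
have : K *m horner_mx W (\prod_(l <- s) ('X - l%:P)) = 0.
  by rewrite -Ws Cayley_Hamilton mulmx0.
elim: s {Ws} K hs => [|l s IHs] K hs.
  by rewrite big_nil rmorph1 mulmx1.
rewrite big_cons rmorphM /= -mulmxE mulmxA rmorphB /= horner_mx_X horner_mx_C.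
move=> /IHs Kl0 KE.
have {Kl0} KW : K *m (W - l%:M) = 0.
  apply: Kl0 => [x xs|]; first by apply: hs; rewrite inE xs orbT.
  have cW : (W - l%:M) *m W = W *m (W - l%:M).
    by rewrite mulmxBl mulmxBr scalar_mxC.
  by rewrite -!mulmxA cW !mulmxA KE.
move/eqP: KW; rewrite mulmxBr mul_mx_scalar subr_eq0 => /eqP KW.
have KlV : K = l *: (V *m K) by rewrite -{1}KE -mulmxA KW scalemxAr.
have [l0 | l0] := eqVneq l 0; first by rewrite KlV l0 scale0r.
have rV : ~~ root (char_poly V) l^-1.
  apply/negP => /hVW /(_ (hs l (mem_head _ _))).
  by rewrite mulVf ?eqxx.
move: rV; rewrite -char_poly_tr -eigenvalue_root_char negbK => /eqP V0.
have : (K^T <= eigenspace V^T l^-1)%MS.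
  apply/eigenspaceP; rewrite -trmx_mul [in RHS]KlV linearZ /= scalerA.
  by rewrite mulVf // scale1r.
by rewrite V0 submx0 => /eqP /(congr1 trmx); rewrite trmxK trmx0.
Qed.

(** * Schur stability and the spectral radius *)

Section SchurStability.
Variable R : realType.

Definition schur_stable k (W : 'M[R]_k) : Prop :=
  forall l : R[i], root (char_poly (toC W)) l -> `|l| < 1.

Lemma toC_block m1 m2 n1 n2 (P : 'M[R]_(m1, n1)) (Q : 'M_(m1, n2))
    (U : 'M_(m2, n1)) (V : 'M_(m2, n2)) :
  toC (block_mx P Q U V) = block_mx (toC P) (toC Q) (toC U) (toC V).
Proof. exact: map_block_mx. Qed.

Lemma schur_stable_ublock m k (P : 'M[R]_m) (Q : 'M_(m, k)) (U : 'M_k) :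
  schur_stable (block_mx P Q 0 U) <-> schur_stable P /\ schur_stable U.
Proof.
have E l : root (char_poly (toC (block_mx P Q 0 U))) l =
    root (char_poly (toC P)) l || root (char_poly (toC U)) l.
  by rewrite toC_block [toC 0]map_mx0 char_poly_ublock rootM.
split=> [h|[hP hU] l]; last by rewrite E => /orP[/hP|/hU].
by split=> l hl; apply: h; rewrite E hl ?orbT.
Qed.

Lemma schur_stable0 k : schur_stable (0 : 'M[R]_k).
Proof.
move=> l; rewrite /toC map_mx0 /char_poly /char_poly_mx map_mx0 subr0 det_scalar.
by rewrite rootE !hornerE expf_eq0 => /andP[_ /eqP->]; rewrite normr0 ltr01.
Qed.

Lemma spectral_radius_lt1 k (W : 'M[R]_k) :
  spectral_radius W < 1 <-> schur_stable W.
Proof.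
have normE (z : R[i]) : `|z| = (ComplexField.Normc.normc z)%:C%C.
  by rewrite normc_def; case: z.
have lt1E (z : R[i]) : (`|z| < 1) = (ComplexField.Normc.normc z < 1).
  by rewrite normE -ltcR.
have [s Ws] := closed_field_poly_normal (char_poly (toC W)).
rewrite (monicP (char_poly_monic _)) scale1r in Ws.
(* A maximum over a finite list keeps the bound strict, which a supremum alone would not. *)
pose r := \big[Num.max/0]_(l <- s) ComplexField.Normc.normc l.
have ubr l : l \in s -> ComplexField.Normc.normc l <= r.
  by move=> ls; rewrite /r; apply: le_bigmax_seq.
have sE l : eigenvalue (toC W) l = (l \in s).
  by rewrite eigenvalue_root_char Ws root_prod_XsubC.
rewrite /spectral_radius; set E := (X in sup X).
split=> [h l | h].
  rewrite lt1E => hl; apply: le_lt_trans h.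
  apply: ub_le_sup; last by exists l; rewrite /= ?eigenvalue_root_char.
  by exists r => y [z /=]; rewrite sE => /ubr zr <-.
(* Without eigenvalues (size 0) the supremum takes its default value 0. *)
have [->|/set0P E0] := eqVneq E set0; first by rewrite sup0 ltr01.
apply: (@le_lt_trans _ _ r).
  by apply: (ge_sup E0) => y [z /=]; rewrite sE => /ubr zr <-.
rewrite /r big_seq; apply: (big_ind (fun x => x < 1)) => [|x y|l]; rewrite ?ltr01 //.
  by rewrite gt_max => -> ->.
by rewrite -lt1E -sE eigenvalue_root_char => /h.
Qed.

(** Two eigenvalues in the open unit disk have a product of modulus below 1, so [stein_eq0] applies
    over the complex numbers. *)
Lemma stein_real_eq0 k (W K : 'M[R]_k) :
  schur_stable W -> W^T *m K *m W = K -> K = 0.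
Proof.
move=> hW KE; apply: (@map_mx_inj _ _ (real_complex R)); rewrite map_mx0.
apply: (@stein_eq0 _ _ _ (toC W)^T (toC W)); last first.
  by rewrite /toC map_trmx -!map_mxM KE.
move=> l u; rewrite char_poly_tr => /hW hl /hW hu.
apply: contraTneq (mulr_ilt1 (normr_ge0 _) (normr_ge0 _) hl hu) => lu.
by rewrite -normrM lu normr1 ltxx.
Qed.

End SchurStability.

(** * Isotropy and rank of stable deflating subspaces *)

Section DeflatingSubspaces.
Variable R : realType.

Lemma stable_deflating_isotropic m k (M : 'M[R]_m) (V : 'M_(m, k)) (T : 'M_k) :
    schur_stable T -> M *m V + M^T *m V *m T = 0 ->
  V^T *m M *m V = 0.
Proof.
move=> hT MV; apply: (stein_real_eq0 hT).
set K := V^T *m M *m V.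
(* The relation multiplied by [V^T] reads K + K^T T = 0. Its transpose turns T^T K into -K^T, which
   yields T^T K T = K. *)
have KT : K = - (K^T *m T).
  apply/eqP; rewrite -addr_eq0 /K !trmx_mul trmxK.
  apply/eqP; transitivity (V^T *m (M *m V + M^T *m V *m T)).
    by rewrite mulmxDr !mulmxA.
  by rewrite MV mulmx0.
have -> : T^T *m K = - K^T.
  by move: K KT => K KT; rewrite [in RHS]KT linearN /= trmx_mul trmxK opprK.
by rewrite mulNmx -KT.
Qed.

(** The columns of [V] are isotropic for the nondegenerate form [M + M^T], so they span at most half
    of the space. *)
Lemma stable_deflating_rank m k (M : 'M[R]_m) (V : 'M_(m, k)) (T : 'M_k) :
    M + M^T \in unitmx -> schur_stable T -> M *m V + M^T *m V *m T = 0 ->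
  (\rank V + \rank V <= m)%N.
Proof.
move=> uM hT MV; have K0 := stable_deflating_isotropic hT MV.
have /mulmx0_rank_max : (V^T *m (M + M^T)) *m V = 0.
  have := congr1 trmx K0; rewrite !trmx_mul trmxK trmx0 mulmxA => K0T.
  by rewrite mulmxDr mulmxDl K0 K0T addr0.
by rewrite mxrankMfree ?row_free_unit // mxrank_tr.
Qed.


Lemma rank_block_mx1 m k p (P : 'M[R]_(m, k)) (Q : 'M_(p, m)) (U : 'M_(p, k)) :
  \rank (block_mx 1%:M P Q U) = (m + \rank (U - Q *m P)%R)%N.
Proof.
(* Block LDU factorization with Schur complement U - QP; the outer factors are invertible. *)
have -> : block_mx 1%:M P Q U = block_mx 1%:M 0 Q 1%:M
    *m block_mx 1%:M 0 0 (U - Q *m P) *m block_mx 1%:M P 0 1%:M.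
  rewrite !mulmx_block !(mul1mx, mul0mx, mulmx0, mulmx1, addr0, add0r).
  by rewrite addrC subrK.
rewrite mxrankMfree; last first.
  by rewrite row_free_unit unitmxE det_ublock !det1 mulr1 unitr1.
rewrite eqmxMfull; last first.
  by rewrite row_full_unit unitmxE det_lblock !det1 mulr1 unitr1.
by rewrite rank_diag_block_mx mxrank1.
Qed.

Lemma rank_row_mxC m k p (P : 'M[R]_(m, k)) (Q : 'M_(m, p)) :
  \rank (row_mx P Q) = \rank (row_mx Q P).
Proof.
by rewrite -mxrank_tr tr_row_mx -addsmxE addsmxC addsmxE -tr_row_mx mxrank_tr.
Qed.

End DeflatingSubspaces.

(** * Degree, leading coefficient and factorization of the determinant of a pencil *)

Section MatrixPencils.
Variable R : realType.

Lemma prod_linear_poly (F : idomainType) N (f : 'I_N -> {poly F}) :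
    (forall i, size (f i) <= 2)%N ->
  (size (\prod_i f i)%R <= N.+1)%N /\ (\prod_i f i)`_N = \prod_i (f i)`_1.
Proof.
elim: N f => [|N IHN] f hf; first by rewrite !big_ord0 size_poly1 coef1.
have [//|szF cF] := IHN (fun i => f (lift ord0 i)).
rewrite !big_ord_recl -cF; move: (\prod_i _) szF => q szq.
have f0E : f ord0 = ((f ord0)`_0)%:P + 'X * ((f ord0)`_1)%:P.
  apply/polyP => -[|[|i]]; rewrite coefD coefC coefXM coefC /= ?addr0 ?add0r //.
  by rewrite nth_default // (leq_trans (hf _)).
split.
  by apply: leq_trans (size_polyMleq _ _) _; have := hf ord0; lia.
rewrite {1}f0E mulrDl coefD coefCM -mulrA coefXM coefCM /=.
by rewrite (nth_default _ szq) mulr0 add0r.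
Qed.

(** Each Leibniz term is a product of N polynomials of degree at most 1. The coefficient of degree N
    decides whether infinity is an eigenvalue. *)
Lemma det_linear_poly (F : idomainType) N (p : 'M[{poly F}]_N) :
    (forall i j, size (p i j) <= 2)%N ->
  (size (\det p) <= N.+1)%N /\ (\det p)`_N = \det (map_mx (coefp 1) p).
Proof.
move=> hp; split.
  apply: (leq_trans (size_sum _ _ _)); apply/bigmax_leqP => s _.
  rewrite -signr_odd mulr_sign; case: ifP => _; rewrite ?size_polyN;
  by have [] := prod_linear_poly (fun i => hp i (s i)).
rewrite /determinant coef_sum; apply: eq_bigr => s _.
have [_ cE] := prod_linear_poly (fun i => hp i (s i)).
under [in RHS]eq_bigr do rewrite mxE.
rewrite -signr_odd -[in RHS]signr_odd !mulr_sign; case: ifP => _;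
  by rewrite ?coefN cE.
Qed.

Lemma pencilE N (P0 P1 : 'M[R]_N) i j :
  pencil P0 P1 i j = (P0 i j)%:C%C%:P + 'X * (P1 i j)%:C%C%:P.
Proof. by rewrite !mxE. Qed.

Lemma size_pencil N (P0 P1 : 'M[R]_N) i j : (size (pencil P0 P1 i j) <= 2)%N.
Proof.
rewrite pencilE; apply/leq_sizeP => -[|[|k]] // _.
by rewrite coefD coefC coefXM coefC /= addr0.
Qed.

Lemma size_det_pencil N (P0 P1 : 'M[R]_N) :
  (size (\det (pencil P0 P1)) <= N.+1)%N.
Proof. by have [] := det_linear_poly (@size_pencil _ P0 P1). Qed.

Lemma coef_det_pencil N (P0 P1 : 'M[R]_N) :
  (\det (pencil P0 P1))`_N = \det (toC P1).
Proof.
have [_ ->] := det_linear_poly (@size_pencil _ P0 P1); congr (\det _).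
apply/matrixP => i j; rewrite mxE pencilE mxE /coefp.
by rewrite coefD coefC coefXM coefC /= add0r.
Qed.

Lemma horner_det_pencil N (P0 P1 : 'M[R]_N) z :
  (\det (pencil P0 P1)).[z] = \det (toC P0 + z *: toC P1).
Proof.
rewrite -[LHS]/(horner_eval z _) -det_map_mx; congr (\det _).
apply/matrixP => i j; rewrite mxE pencilE /= /horner_eval.
by rewrite hornerD hornerM hornerX !hornerC !mxE.
Qed.

(** Substituting P = -EW gives P + zE = E(z - W). *)
Lemma det_pencil_factor N (P E W : 'M[R]_N) :
  P + E *m W = 0 ->
  \det (pencil P E) = (\det (toC E))%:P * char_poly (toC W).
Proof.
move=> /eqP; rewrite addr_eq0 => /eqP ->.
rewrite -det_map_mx -det_mulmx; congr (\det _).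
rewrite /pencil /const_mxpoly /char_poly_mx mulmxBr mul_mx_scalar addrC.
by congr (_ + _); rewrite /toC map_mxN map_mxM map_mxN map_mxM.
Qed.

End MatrixPencils.

(** * Solutions of the Riccati equation as deflating graphs *)

Section TRiccatiEquation.
Variables (R : realType) (n : nat) (A B C D : 'M[R]_n).

Local Notation M := (calM A B C D).
Local Notation U S := (col_mx 1%:M S : 'M[R]_(n + n, n)).
Local Notation P S := (A - B *m S).
Local Notation E S := (D^T - B^T *m S).

Lemma calM_graph (S : 'M[R]_n) : M *m U S = col_mx (C + D *m S) (P S).
Proof. by rewrite mul_block_col !mulmx1 mulNmx. Qed.

Lemma calMT_graph (S : 'M[R]_n) :
  M^T *m U S = col_mx (C^T + A^T *m S) (E S).
Proof. by rewrite tr_block_mx mul_block_col !mulmx1 linearN mulNmx. Qed.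

Lemma rank_graph (S : 'M[R]_n) : \rank (U S) = n.
Proof.
apply/eqP; rewrite -[_ == _]/(row_full _); apply/row_fullP.
by exists (row_mx 1%:M 0); rewrite mul_row_col mulmx1 mul0mx addr0.
Qed.

Lemma tRiccati_solutionE (S : 'M[R]_n) :
  tRiccati_solution A B C D S <-> (U S)^T *m M *m U S = 0.
Proof.
rewrite -mulmxA calM_graph tr_col_mx trmx1 mul_row_col mul1mx mulmxBr mulmxA.
by rewrite /tRiccati_solution [X in X = 0 <-> _]addrC !addrA; split.
Qed.

Lemma tRiccati_deflating (S : 'M[R]_n) : tRiccati_solution A B C D S ->
  M *m U S = col_mx (- S^T) 1%:M *m P S /\
  M^T *m U S = col_mx (- S^T) 1%:M *m E S.
Proof.
move=> hS; have hC : C + D *m S = - S^T *m P S.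
  apply/eqP; rewrite mulNmx -addr_eq0 mulmxBr mulmxA -[X in _ == X]hS.
  by apply/eqP; rewrite [in RHS]addrC !addrA.
rewrite calM_graph calMT_graph !mul_col_mx !mul1mx hC; split=> //.
congr col_mx; rewrite mulNmx.
(* The coefficient of z in the deflating identity comes from the transposed equation. *)
have hST := congr1 trmx hS.
rewrite trmx0 !linearD linearN /= !trmx_mul !trmxK in hST.
apply/eqP; rewrite -addr_eq0 mulmxBr mulmxA -[X in _ == X]hST mulmxA.
apply/eqP; rewrite [RHS]addrC -!addrA; congr (_ + _).
by rewrite [RHS]addrCA.
Qed.

Lemma stabilizing_deflates (S : 'M[R]_n) : stabilizing_solution A B C D S ->
  let W := - (invmx (E S) *m P S) in
  [/\ E S \in unitmx, schur_stable W & M *m U S + M^T *m U S *m W = 0].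
Proof.
move=> [hS reg hev] W.
have uE : E S \in unitmx.
  (* As infinity is not an eigenvalue, det alpha has degree exactly n, and its leading coefficient
     is det [E S]. *)
  have : ~~ is_eig 1 (alpha A B D S) None by apply/negP => /hev.
  rewrite /is_eig /= mul1n -eqn0Ngt subn_eq0 => sz.
  rewrite unitmxE unitfE -(fmorph_eq0 (real_complex R)) -det_map_mx.
  rewrite -[map_mx _ _]/(toC (E S)) -(coef_det_pencil (P S)).
  have := size_det_pencil (P S) (E S).
  move: sz reg; rewrite /regular /alpha; set d := \det _ => sz d0 szd.
  rewrite -size_poly_gt0 in d0.
  have nE : (size d).-1 = n by apply/eqP; rewrite eqn_leq sz -ltnS prednK ?szd.
  by rewrite -[X in d`_X]nE -lead_coefE lead_coef_eq0 -size_poly_gt0.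
have PE : P S + E S *m W = 0 by rewrite mulmxN mulmxA mulmxV // mul1mx subrr.
split=> // [l Wl|].
  apply: (hev (Some l)); rewrite /is_eig /= -XsubC_dvd // -root_factor_theorem.
  by rewrite (det_pencil_factor PE) rootM Wl orbT.
have [-> ->] := tRiccati_deflating hS.
by rewrite -mulmxA -mulmxDr PE mulmx0.
Qed.

Hypothesis uM : M + M^T \in unitmx.

(** The relation gives (M + M^T) V = M^T V (1 - T), and the left side has the rank of [V]. *)
Lemma deflating_rank k (V : 'M[R]_(n + n, k)) (T : 'M_k) :
  M *m V + M^T *m V *m T = 0 -> (\rank V <= \rank (M^T *m V))%N.
Proof.
move/eqP; rewrite addr_eq0 => /eqP MV.
have : (M + M^T) *m V = M^T *m V *m (1%:M - T).
  by rewrite mulmxDl MV mulmxBr mulmx1 addrC.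
move/(congr1 mxrank); rewrite eqmxMfull ?row_full_unit // => ->.
exact: mxrankM_maxl.
Qed.

Lemma deflating_stabilizing (S W : 'M[R]_n) :
    schur_stable W -> M *m U S + M^T *m U S *m W = 0 ->
  stabilizing_solution A B C D S.
Proof.
move=> hW MU.
have hS : tRiccati_solution A B C D S.
  by apply/tRiccati_solutionE; apply: stable_deflating_isotropic hW MU.
(* M^T U_S has rank at least n and factors through the square matrix [E S]. *)
have uE : E S \in unitmx.
  have := deflating_rank MU; rewrite rank_graph.
  have [_ ->] := tRiccati_deflating hS.
  by move/leq_trans/(_ (mxrankM_maxr _ _)); rewrite -row_full_unit -col_leq_rank.
have PE : P S + E S *m W = 0.
  have := congr1 dsubmx MU.
  by rewrite calM_graph calMT_graph mul_col_mx add_col_mx col_mxKd linear0.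
have dE0 : \det (toC (E S)) != 0.
  by rewrite det_map_mx fmorph_eq0 -unitfE -unitmxE.
have dE := det_pencil_factor PE.
have szd : size (\det (alpha A B D S)) = n.+1.
  by rewrite /alpha dE size_Cmul // size_char_poly.
have reg : regular (alpha A B D S) by rewrite /regular -size_poly_gt0 szd.
split=> // -[l|]; last by rewrite /is_eig /= szd mul1n subnn.
rewrite /is_eig /= -XsubC_dvd // -root_factor_theorem /alpha dE rootM rootC.
by rewrite (negPf dE0) => /hW.
Qed.

Lemma stabilizing_unique (S S' W W' : 'M[R]_n) :
    schur_stable W -> M *m U S + M^T *m U S *m W = 0 ->
    schur_stable W' -> M *m U S' + M^T *m U S' *m W' = 0 ->
  S' = S.
Proof.
move=> hW MU hW' MU'.
(* The joined graphs [U_S U_S'] satisfy one relation, with this stable block diagonal matrix. *)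
have hT : schur_stable (block_mx W 0 0 W') by apply/schur_stable_ublock.
have MV : M *m row_mx (U S) (U S') +
    M^T *m row_mx (U S) (U S') *m block_mx W 0 0 W' = 0.
  rewrite !mul_mx_row mul_row_block !mulmx0 addr0 add0r add_row_mx MU MU'.
  exact: row_mx0.
have := stable_deflating_rank uM hT MV.
(* The rank is n + rank (S' - S), and twice it is at most 2n. *)
rewrite -block_mxEh rank_block_mx1 mulmx1 => rV.
by apply/eqP; rewrite -subr_eq0 -mxrank_eq0; move: (\rank _) rV => r; lia.
Qed.

(** * The quadratic matrix equation; [J + z L] is the factor multiplying phi(z) in Q(z) *)

Local Notation J := (block_mx 0 1%:M 0 0 : 'M[R]_(n + n)).
Local Notation L := (block_mx 0 0 1%:M 0 : 'M[R]_(n + n)).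

Lemma calAm1E : calAm1 A C = M *m J.
Proof.
by rewrite mulmx_block !(mulmx0, mulmx1, addr0).
Qed.

Lemma calA0E : calA0 B C D = M *m L + M^T *m J.
Proof.
rewrite tr_block_mx !mulmx_block !(mulmx0, mulmx1, addr0, add0r).
by rewrite add_block_mx !(addr0, add0r).
Qed.

Lemma calA1E : calA1 A B = M^T *m L.
Proof.
by rewrite tr_block_mx mulmx_block !(mulmx0, mulmx1, addr0, add0r) linearN.
Qed.

(** The factorization Q(z) = (M + z M^T)(J + z L) carries over to [G], with powers of [G] on the
    right. *)
Lemma qme_deflating (G : 'M[R]_(n + n)) : qme_solution A B C D G ->
  M *m (J + L *m G) + M^T *m (J + L *m G) *m G = 0.
Proof.
move=> <-; rewrite calAm1E calA0E calA1E !(mulmxDl, mulmxDr) !mulmxA.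
by rewrite !addrA.
Qed.

Lemma qme_stabilizing (G : 'M[R]_(n + n)) :
    qme_solution A B C D G -> schur_stable G ->
  exists S W, [/\ G = block_mx 0 S 0 W, schur_stable W
                & M *m U S + M^T *m U S *m W = 0].
Proof.
move=> qG hG; have MV := qme_deflating qG.
have rV := stable_deflating_rank uM hG MV.
have rMV := deflating_rank MV.
move: hG MV rV rMV; rewrite -[G]submxK.
move: (ulsubmx G) (ursubmx G) (dlsubmx G) (drsubmx G) => G1 S G2 W {qG}.
have -> : J + L *m block_mx G1 S G2 W = row_mx (col_mx 0 G1) (U S).
  rewrite mulmx_block !(mul0mx, mul1mx, addr0) add_block_mx !(addr0, add0r).
  exact: block_mxEh.
(* After the block columns are swapped, [V] is [I 0; S G1], of rank n + rank G1, and the rank bound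
   leaves G1 = 0. *)
move=> hG MV; rewrite rank_row_mxC -block_mxEh rank_block_mx1 mulmx0 subr0.
move=> rV; have /eqP : \rank G1 = 0%N by move: (\rank G1) rV => r; lia.
rewrite mxrank_eq0 => /eqP G10; move: hG MV; rewrite G10 mxrank0 col_mx0.
rewrite !mul_mx_row !mulmx0 mul_row_block rank_row_0mx !mul0mx !add0r add_row_mx.
rewrite add0r addn0 => hG /eqP; rewrite row_mx_eq0 => /andP[/eqP MG2 /eqP MU] rU.
(* The first block column of the relation is now M^T U_S G2 = 0, and M^T U_S has independent
   columns. *)
have fullU : row_full (M^T *m U S) by rewrite -col_leq_rank.
have G20 : G2 = 0 by apply: (row_full_inj fullU); rewrite MG2 mulmx0.
exists S, W; split=> //; first by rewrite G20.
by move: hG; rewrite G20 => /schur_stable_ublock[].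
Qed.

Lemma deflating_qme (S W : 'M[R]_n) : M *m U S + M^T *m U S *m W = 0 ->
  qme_solution A B C D (block_mx 0 S 0 W).
Proof.
rewrite /qme_solution calM_graph calMT_graph mul_col_mx add_col_mx.
move/eqP; rewrite col_mx_eq0 => /andP[/eqP hC /eqP hP].
rewrite !mulmx_block !(mul0mx, mulmx0, addr0, add0r) !add_block_mx !addr0.
rewrite -[RHS]block_mx0; congr block_mx.
  by rewrite -[RHS]hC mulmxDl !mulmxA !addrA.
by rewrite -[RHS]hP mulmxBl !mulNmx !mulmxA !addrA.
Qed.

(** * The eigenvalues of Q(z) *)

Lemma calQE :
  calQ A B C D = quadratic (calAm1 A C) (calA0 B C D) (calA1 A B).
Proof.
have -> : calQ A B C D =
    phi A B C D *m (const_mxpoly J + 'X *: const_mxpoly L).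
  rewrite /calQ /const_mxpoly !toC_block !map_block_mx /toC !map_mx0 !map_mx1.
  by rewrite scale_block_mx add_block_mx scalemx1 !scaler0 !(addr0, add0r).
rewrite calAm1E calA0E calA1E /quadratic /phi /pencil /const_mxpoly /toC.
rewrite !(map_mxD, map_mxM) !(mulmxDl, mulmxDr) -!(scalemxAl, scalemxAr) scalerA.
by rewrite scalerDr -expr2 !addrA.
Qed.

Lemma det_calQ : exists2 c : R[i], c != 0 &
  \det (calQ A B C D) = \det (phi A B C D) * c%:P * 'X^n.
Proof.
pose K : 'M[R[i]]_(n + n) := block_mx 0 1%:M 1%:M 0.
exists (\det K).
  rewrite -unitfE -unitmxE; apply: (mulmx1_unit (B := K) _).1.
  by rewrite mulmx_block !(mulmx0, mulmx1, addr0, add0r) -scalar_mx_block.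
rewrite /calQ det_mulmx -mulrA; congr (_ * _).
(* The block swap [K], its own inverse, splits off diag(zI, I), whose determinant is z^n. *)
have -> : block_mx 0 1%:M 'X%:M 0 =
    map_mx polyC K *m block_mx 'X%:M 0 0 1%:M :> 'M_(n + n).
  rewrite map_block_mx !map_mx0 !map_mx1 mulmx_block.
  by rewrite !(mul0mx, mul1mx, mulmx0, addr0, add0r).
by rewrite det_mulmx det_map_mx det_ublock det1 mulr1 det_scalar.
Qed.

Lemma eig_mult_calQ (x : option R[i]) : regular (phi A B C D) ->
  eig_mult 2 (calQ A B C D) x =
  (eig_mult 1 (phi A B C D) x
   + (if x == Some 0%R then n else 0)
   + (if x == None then n else 0))%N.
Proof.
rewrite /regular; have [c c0 dQ] := det_calQ.
have szp : (size (\det (phi A B C D)) <= (n + n).+1)%N := size_det_pencil _ _.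
case: x => [l|] p0 /=; rewrite dQ.
  rewrite mupM ?mulf_neq0 ?polyC_eq0 ?expf_neq0 ?polyX_eq0 //.
  rewrite mupMl ?rootC // addn0 -['X]subr0 -polyC0 mup_XsubCX.
  by rewrite [Some l == _]/(l == 0) eq_sym.
(* If d is the degree of det phi, infinity has multiplicity 4n - (d + n) = (2n - d) + n; [szp] gives
   d <= 2n, so nothing truncates. *)
rewrite size_mulXn ?mulf_neq0 ?polyC_eq0 // mulrC size_Cmul //.
rewrite -size_poly_gt0 in p0.
by move: (size _) szp p0 => d; lia.
Qed.

End TRiccatiEquation.

Theorem theorem11 (R : realType) (n : nat) (A B C D : 'M[R]_n)
  (hphi : forall z : R[i], `|z| = 1 -> (\det (phi A B C D)).[z] != 0) :
  [/\ calQ A B C D = quadratic (calAm1 A C) (calA0 B C D) (calA1 A B),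
      regular (phi A B C D) /\ regular (calQ A B C D),
      forall x : option R[i],
        eig_mult 2 (calQ A B C D) x =
        (eig_mult 1 (phi A B C D) x
         + (if x == Some (0%R : R[i]) then n else 0)
         + (if x == None then n else 0))%N,
      (exists S : 'M[R]_n, stabilizing_solution A B C D S) <->
      (exists G : 'M[R]_(n + n),
         qme_solution A B C D G /\ spectral_radius G < 1)
    & forall (S : 'M[R]_n) (G : 'M[R]_(n + n)),
        stabilizing_solution A B C D S ->
        qme_solution A B C D G -> spectral_radius G < 1 ->
        (D^T - B^T *m S) \in unitmx /\
        G = block_mx 0 S
                     0 (- (invmx (D^T - B^T *m S) *m (A - B *m S)))].
Proof.
have reg : regular (phi A B C D).
  by have := hphi 1 (normr1 _); apply: contraTneq => ->;
    rewrite horner0 eqxx.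
(* This matrix is phi(1), and 1 lies on the unit circle. *)
have uM : calM A B C D + (calM A B C D)^T \in unitmx.
  rewrite unitmxE unitfE -(fmorph_eq0 (real_complex R)) -det_map_mx.
  have := hphi 1 (normr1 _); rewrite /phi horner_det_pencil scale1r.
  by rewrite /toC -map_mxD.
split.
- exact: calQE.
- split=> //; rewrite /regular; have [c c0 ->] := det_calQ A B C D.
  by rewrite !mulf_neq0 ?polyC_eq0 ?expf_neq0 ?polyX_eq0.
- by move=> x; exact: eig_mult_calQ.
- split=> [[S hS]|[G [qG /spectral_radius_lt1 hG]]].
    have [_ hW MU] := stabilizing_deflates hS.
    exists (block_mx 0 S 0 (- (invmx (D^T - B^T *m S) *m (A - B *m S)))).
    split; first exact: deflating_qme.
    apply/spectral_radius_lt1/schur_stable_ublock; split=> //.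
    exact: schur_stable0.
  have [S [W [_ hW MU]]] := qme_stabilizing uM qG hG.
  by exists S; apply: deflating_stabilizing MU.
move=> S G hS qG /spectral_radius_lt1 hG.
have [uE hW MU] := stabilizing_deflates hS; split=> //.
have [S' [W' [-> hW' MU']]] := qme_stabilizing uM qG hG.
have SS' := stabilizing_unique uM hW MU hW' MU'.
rewrite {}SS' in MU' *; congr block_mx.
(* The lower block of the relation is (A - BS) + (D^T - B^T S) W' = 0, which determines W'. *)
have := congr1 dsubmx MU'.
rewrite calM_graph calMT_graph mul_col_mx add_col_mx col_mxKd linear0.
move/eqP; rewrite addrC addr_eq0 => /eqP EW.
by rewrite -[LHS](mulKmx uE) EW mulmxN.
Qed.
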